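(* Let $a\in\mathcal{B}$, write $\xi_0=\xi_0(a)$, and assume that $m+q>2$. Then, as $\xi\to\xi_0$ (from the left), $$f(\xi;a)=K_3\,\xi_0^{(\sigma-1)/(1-q)}(\xi_0-\xi)^{1/(1-q)}+o\big((\xi_0-\xi)^{1/(1-q)}\big),$$ where $$K_3:=\left(\frac{1-q}{\beta}\right)^{1/(1-q)}.$$
   Context: Standing assumptions: $N\ge1$ is an integer, $m>1$, $q\in(0,1)$, $\sigma>\frac{2(1-q)}{m-1}$, and $$\alpha=\frac{\sigma+2}{\sigma(m-1)+2(q-1)}>0,\qquad \beta=\frac{m-q}{\sigma(m-1)+2(q-1)}>0.$$ For $a>0$, $F(\cdot;a)\in C^2([0,\xi_{\max}(a)))$ is the unique positive solution, on its maximal interval $[0,\xi_{\max}(a))$, of $$F''(\xi)+\frac{N-1}{\xi}F'(\xi)+\alpha F^{1/m}(\xi)-\beta\xi(F^{1/m})'(\xi)-\xi^\sigma F^{q/m}(\xi)=0,\qquad F(0)=a^m,\ F'(0)=0,$$ where either $\xi_{\max}(a)=\infty$, or $\xi_{\max}(a)<\infty$ and $F(\xi;a)+1/F(\xi;a)\to\infty$ as $\xi\to\xi_{\max}(a)$. Set $f(\cdot;a):=F(\cdot;a)^{1/m}$. $\xi_0(a)\in(0,\infty]$ is the first zero of $F(\cdot;a)$: $\xi_0(a)=\xi_{\max}(a)$ if $\xi_{\max}(a)<\infty$ and $F(\xi;a)\to0$ as $\xi\to\xi_{\max}(a)$ (then $F(\xi_0(a);a)=f(\xi_0(a);a)=0$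 and $(f^m)'(\xi_0(a);a)$ is the left derivative), and $\xi_0(a)=\infty$ otherwise. Also $\xi_1(a):=\sup\{\xi\in(0,\xi_0(a)),\ \xi<\xi_{\max}(a): F'(\cdot;a)<0\text{ on }(0,\xi)\}>0$. The sets are $$\mathcal{A}:=\{a>0:\ \xi_0(a)<\infty\text{ and }(f^m)'(\xi;a)<0\text{ for }\xi\in(0,\xi_0(a)]\},\quad \mathcal{C}:=\{a>0:\ \xi_1(a)<\xi_0(a)\},\quad \mathcal{B}:=(0,\infty)\setminus(\mathcal{A}\cup\mathcal{C}).$$ For $a\in\mathcal{B}$ one has $\xi_0(a)<\infty$. *)

(* Defs.v *)
From HB Require Import structures.
From mathcomp Require Import all_boot all_order all_algebra.
From mathcomp Require Import all_classical all_reals all_analysis.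
Import Order.TTheory GRing.Theory Num.Theory.
Import numFieldNormedType.Exports.

Set Implicit Arguments.
Unset Strict Implicit.
Unset Printing Implicit Defensive.

Local Open Scope ring_scope.
Local Open Scope classical_set_scope.

(* [g] has derivative [l] at [x] relative to the set [D]: this is the usual
   derivative at an interior point of [D], and a one-sided derivative at an
   endpoint of an interval [D]. *)
Definition is_derive_within (R : realType) (D : set R) (g : R -> R)
    (x l : R) : Prop :=
  (g y - g x) / (y - x) @[y --> within D x^'] --> l.

Definition C2_on (R : realType) (D : set R) (g : R -> R) : Prop :=
  exists g1 g2 : R -> R,
    [/\ forall x, D x -> is_derive_within D g x (g1 x),
        forall x, D x -> is_derive_within D g1 x (g2 x) &
        {within D, continuous g2}].

Definition alpha (R : realType) (m q sigma : R) : R :=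
  (sigma + 2) / (sigma * (m - 1) + 2 * (q - 1)).

Definition beta (R : realType) (m q sigma : R) : R :=
  (m - q) / (sigma * (m - 1) + 2 * (q - 1)).

Definition K3 (R : realType) (m q sigma : R) : R :=
  ((1 - q) / beta m q sigma) `^ (1 - q)^-1.

(* The function f = F^(1/m). *)
Definition prof (R : realType) (m : R) (F : R -> R) : R -> R :=
  fun x => F x `^ m^-1.

Definition ode_at (R : realType) (N : nat) (m q sigma : R) (F : R -> R)
    (x : R) : Prop :=
  derive1 (derive1 F) x + (N%:R - 1) / x * derive1 F x
  + alpha m q sigma * F x `^ m^-1
  - beta m q sigma * x * derive1 (prof m F) x
  - x `^ sigma * F x `^ (q / m) = 0.

(* [F], considered on [0, ximax) only, is the positive solution with shooting
   parameter [a], and [ximax] is the end of its maximal interval; values of [F]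
   outside [0, ximax) are irrelevant. The equation is singular at 0, hence is
   imposed for x > 0 only. *)
Definition maximal_solution (R : realType) (N : nat) (m q sigma a : R)
    (F : R -> R) (ximax : \bar R) : Prop :=
  let D := [set x : R | 0 <= x /\ (x%:E < ximax)%E] in
  [/\ (0 < ximax)%E,
      C2_on D F /\ (forall x, D x -> 0 < F x),
      forall x, 0 < x -> (x%:E < ximax)%E -> ode_at N m q sigma F x,
      F 0 = a `^ m /\ is_derive_within D F 0 0 &
      ximax = +oo%E \/
      exists2 b : R, ximax = b%:E & F x + (F x)^-1 @[x --> b^'-] --> +oo].

Definition xi0 (R : realType) (F : R -> R) (ximax : \bar R) : \bar R :=
  if `[< exists2 b : R, ximax = b%:E & F x @[x --> b^'-] --> (0 : R) >]
  then ximax else +oo%E.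

Definition xi1 (R : realType) (F : R -> R) (ximax : \bar R) : \bar R :=
  ereal_sup [set x%:E | x in
    [set x : R | [/\ 0 < x, (x%:E < xi0 F ximax)%E, (x%:E < ximax)%E &
                  forall y, 0 < y < x -> derive1 F y < 0]]].

(* Extension of [F] by the value 0 at (and beyond) [b]; used with b = xi0. *)
Definition zero_ext (R : realType) (b : R) (F : R -> R) : R -> R :=
  fun x => if x < b then F x else 0.

Definition setA (R : realType) (m : R) (F : R -> R -> R)
    (ximax : R -> \bar R) : set R :=
  [set a | 0 < a /\ exists2 b : R, xi0 (F a) (ximax a) = b%:E &
    forall x, 0 < x <= b -> exists2 l : R, l < 0 &
      is_derive_within [set y | 0 <= y <= b]
        (fun y => prof m (zero_ext b (F a)) y `^ m) x l].

Definition setC (R : realType) (F : R -> R -> R)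
    (ximax : R -> \bar R) : set R :=
  [set a | 0 < a /\ (xi1 (F a) (ximax a) < xi0 (F a) (ximax a))%E].

Definition setB (R : realType) (m : R) (F : R -> R -> R)
    (ximax : R -> \bar R) : set R :=
  [set a | 0 < a] `\` (setA m F ximax `|` setC F ximax).

(* Main.v *)
(* Write u = F^(1/m), P = -F' and W = P u^(1-m-q) = -m u'/u^q. The equation,
   put in divergence form, gives F' a limit at x0; this limit is 0, since
   otherwise a would lie in A, so P tends to 0. In terms of W the equation reads
     u^(m-1) W' = (beta x/m - (N-1) u^(m-1)/x) W - x^sigma + o(1),
   where the quadratic term hidden in o(1) is W^2 u^(m+q-2), which vanishes for
   bounded W because m + q > 2. The rest point W* = m x0^(sigma-1)/beta is
   repelling: above W*, W and P increase forever, contradicting P -> 0; below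
   W*, W' <= - delta u^(1-m), which is not integrable up to x0, contradicting
   W > 0. Hence W -> W*, so (u^(1-q))' -> - (1-q) x0^(sigma-1)/beta, and
   l'Hopital's rule concludes. *)

Require Import Defs.
From HB Require Import structures.
From mathcomp Require Import all_boot all_order all_algebra.
From mathcomp Require Import all_classical all_reals all_analysis.
From mathcomp Require Import ring lra.
Import Order.TTheory GRing.Theory Num.Theory.
Import numFieldNormedType.Exports.
Local Open Scope ring_scope.
Local Open Scope classical_set_scope.

(** * Calculus and trapping arguments on a left neighbourhood of a point *)

Lemma near_left_itvP (R : realType) (e : R) (Q : R -> Prop) :
  (\forall x \near e^'-, Q x) <->
  (exists2 b, b < e & forall x, x \in `]b, e[%R -> Q x).
Proof.
split=> [|[b be bQ]]; last first.
  near=> x; apply: bQ; rewrite in_itv/=; apply/andP; split; near: x.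
    exact: nbhs_left_gt.
  exact: nbhs_left_lt.
rewrite near_withinE => /nbhs_ballP[r /= r0 rQ].
exists (e - r); first by rewrite ltrBlDr ltrDl.
move=> x; rewrite in_itv/= => /andP[rx xe]; apply: rQ => //.
by rewrite /ball/= gtr0_norm ?subr_gt0//; lra.
Unshelve. all: by end_near. Qed.

Lemma is_derive_ge0_le (R : realType) (f df : R -> R) (b e : R) :
  (forall x, x \in `]b, e[%R -> is_derive x 1 f (df x)) ->
  (forall x, x \in `]b, e[%R -> 0 <= df x) ->
  {in `]b, e[%R &, {homo f : x y / x <= y}}.
Proof.
move=> fd df0; apply: ger0_derive1_le_oo => [x xbe|x xbe|x /[!inE] xbe].
- by have [] := fd x xbe.
- by rewrite derive1E; have [_ ->] := fd x xbe; exact: df0.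
- by apply/differentiable_continuous/derivable1_diffP; have [] := fd x xbe.
Qed.

(** The substitution [y = x + h] links the increment form of the derivative to the slopes used in
    [is_derive_within]. *)
Lemma is_derive_slopeP (R : realType) (f : R -> R) (x l : R) :
  is_derive x 1 f l <-> (f y - f x) / (y - x) @[y --> x^'] --> l.
Proof.
have -> : ((f y - f x) / (y - x) @[y --> x^'] --> l) <->
    (h^-1 *: ((f \o shift x) (h *: (1 : R)) - f x) @[h --> 0^'] --> l).
  rewrite !cvgrPdist_lt; split=> fl eps eps0; have := fl _ eps0;
      rewrite !near_withinE.
    move=> /nbhs0P; apply: filterS => h /= hl h0.
    have := hl _; rewrite -subr_eq0 addrC addKr => /(_ h0).
    by rewrite /= scaler1 (addrC h) mulrC.
  move=> xl; apply/(@nbhs0P R R^o); move: xl; apply: filterS => h /= hl xh.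
  have h0 : h != 0 by move: xh; rewrite -subr_eq0 addrC addKr.
  by rewrite (addrC x h) addrK mulrC; have := hl h0; rewrite /= scaler1.
split=> [[fx <-] //|fl].
by split; [apply/cvg_ex; exists l | exact: cvg_lim].
Qed.

(** If [W y < c], a maximum point [z] of [W] on [[x, y]] has [W z >= c] and differs from [y]; the
    positive derivative at [z] then gives larger values just to its right. *)
Lemma superlevel_trapped (R : realType) (W dW : R -> R) (b e c : R) :
  (forall x, x \in `]b, e[%R -> is_derive x 1 W (dW x)) ->
  (forall x, x \in `]b, e[%R -> c <= W x -> 0 < dW x) ->
  forall x y, b < x -> x <= y -> y < e -> c <= W x -> c <= W y.
Proof.
move=> Wd dW0 x y bx xy ye cx; rewrite leNgt; apply/negP => yc.
have sub z : z \in `[x, y]%R -> z \in `]b, e[%R.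
  rewrite !in_itv/= => /andP[xz zy].
  by rewrite (lt_le_trans bx xz) (le_lt_trans zy ye).
have [|z zxy zmax] := @EVT_max _ W _ _ xy.
  apply: derivable_within_continuous => z /sub zbe.
  by have [] := Wd z zbe.
have xz : x <= z by move: zxy; rewrite in_itv/= => /andP[].
have cz : c <= W z by rewrite (le_trans cx)// zmax// in_itv/= lexx xy.
have zy : z < y.
  move: (zxy); rewrite in_itv/= => /andP[_]; rewrite le_eqVlt => /predU1P[zy|//].
  by move: yc; rewrite -zy ltNge cz.
have dz : 0 < dW z by apply: dW0 => //; exact: sub.
have /is_derive_slopeP/cvg_dnbhs_at_right/cvgr_gt/(_ _ dz) Wz := Wd z (sub _ zxy).
have [t [zt ty tW]] : exists t, [/\ z < t, t < y & 0 < (W t - W z) / (t - z)].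
  near z^'+ => t; exists t; split; near: t => //.
    exact: nbhs_right_gt.
  exact: nbhs_right_lt.
have : W t <= W z.
  by rewrite zmax// in_itv/= (ltW ty) andbT (le_trans xz)// ltW.
by move: tW; rewrite pmulr_lgt0 ?invr_gt0 ?subr_gt0// ltNge => /negP.
Unshelve. all: by end_near. Qed.

(** Once [W] reaches [c] it stays above, so from there on the positive function [P] is nondecreasing
    and cannot tend to 0. *)
Lemma near_lt_of_expelled (R : realType) (W dW P dP : R -> R) (e c : R) :
  (\forall x \near e^'-, is_derive (x : R) 1 W (dW x)) ->
  (\forall x \near e^'-, is_derive (x : R) 1 P (dP x)) ->
  (\forall x \near e^'-, 0 < P x) ->
  (\forall x \near e^'-, c <= W x -> 0 < dW x /\ 0 < dP x) ->
  P x @[x --> e^'-] --> 0 ->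
  \forall x \near e^'-, W x < c.
Proof.
move=> nW nP nP0 nd P0.
have [b be bP] : exists2 b, b < e & forall x, x \in `]b, e[%R ->
    [/\ is_derive x 1 W (dW x), is_derive x 1 P (dP x), 0 < P x &
        c <= W x -> 0 < dW x /\ 0 < dP x].
  by apply/near_left_itvP; near do split.
apply/near_left_itvP; exists b => // x /[!in_itv]/= /andP[bx xe].
rewrite ltNge; apply/negP => cx.
have Wc y : x <= y -> y < e -> c <= W y.
  move=> xy ye; apply: (@superlevel_trapped _ W dW b e c _ _ x) => //.
    by move=> z /bP[].
  by move=> z /bP[_ _ _] h /h[].
have sub z : x < z -> z < e -> z \in `]b, e[%R.
  by move=> xz ze; rewrite in_itv/= (lt_trans bx xz).
have Pmono : {in `]x, e[%R &, {homo P : y z / y <= z}}.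
  apply: (@is_derive_ge0_le _ P dP) => z /[!in_itv]/= /andP[xz ze].
    by have [] := bP z (sub _ xz ze).
  have [_ _ _ h] := bP z (sub _ xz ze).
  by apply/ltW; have [] := h (Wc z (ltW xz) ze).
pose y := (x + e) / 2.
have [xy ye] : x < y /\ y < e by rewrite /y; split; lra.
have [_ _ Py _] := bP y (sub _ xy ye).
have [z [yz ze]] : exists z, [/\ y < z, z < e & P z < P y].
  near e^'- => z; exists z; split; near: z.
  - exact: nbhs_left_gt.
  - exact: nbhs_left_lt.
  - exact: cvgr_lt P0 _ Py.
by rewrite ltNge Pmono// ?in_itv/= ?xy ?ye ?(lt_trans xy yz) ?ze//; exact: ltW.
Unshelve. all: by end_near. Qed.

(** Once [W <= c], trapping applied to [- W] keeps it so, and [W + Z] is nonincreasing; as [W > 0],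
    this bounds [Z] from above, against its divergence. *)
Lemma near_gt_of_absorbed (R : realType) (W dW Z dZ : R -> R) (e c : R) :
  (\forall x \near e^'-, is_derive (x : R) 1 W (dW x)) ->
  (\forall x \near e^'-, is_derive (x : R) 1 Z (dZ x)) ->
  (\forall x \near e^'-, 0 < W x) ->
  (\forall x \near e^'-, W x <= c -> dW x < 0 /\ dW x + dZ x <= 0) ->
  Z x @[x --> e^'-] --> +oo ->
  \forall x \near e^'-, c < W x.
Proof.
move=> nW nZ nW0 nd Zoo.
have [b be bP] : exists2 b, b < e & forall x, x \in `]b, e[%R ->
    [/\ is_derive x 1 W (dW x), is_derive x 1 Z (dZ x), 0 < W x &
        W x <= c -> dW x < 0 /\ dW x + dZ x <= 0].
  by apply/near_left_itvP; near do split.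
apply/near_left_itvP; exists b => // x /[!in_itv]/= /andP[bx xe].
rewrite ltNge; apply/negP => cx.
have Wc y : x <= y -> y < e -> W y <= c.
  move=> xy ye; rewrite -lerN2.
  apply: (@superlevel_trapped _ (- W) (- dW) b e (- c) _ _ x) => //.
  - by move=> z /bP[? _ _ _]; exact: is_deriveN.
  - by move=> z /bP[_ _ _]; rewrite lerN2 oppr_gt0 => h /h[].
  - by rewrite lerN2.
have sub z : x < z -> z < e -> z \in `]b, e[%R.
  by move=> xz ze; rewrite in_itv/= (lt_trans bx xz).
have Hmono : {in `]x, e[%R &, {homo - (W + Z) : y z / y <= z}}.
  apply: (@is_derive_ge0_le _ _ (- (dW + dZ))) => z /[!in_itv]/= /andP[xz ze].
    have [? ? _ _] := bP z (sub _ xz ze); by apply: is_deriveN; exact: is_deriveD.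
  have [_ _ _ h] := bP z (sub _ xz ze).
  by rewrite oppr_ge0; have [] := h (Wc z (ltW xz) ze).
pose y := (x + e) / 2.
have [xy ye] : x < y /\ y < e by rewrite /y; split; lra.
have [t [yt te tZ]] : exists t, [/\ y < t, t < e & W y + Z y < Z t].
  near e^'- => t; exists t; split; near: t.
  - exact: nbhs_left_gt.
  - exact: nbhs_left_lt.
  - exact: cvgry_gt.
have xt := lt_trans xy yt.
have [_ _ Wt _] := bP t (sub _ xt te).
have := Hmono y t; rewrite !in_itv/= xy ye xt te => /(_ erefl erefl (ltW yt)).
by rewrite lerN2 leNgt => /negP; apply; rewrite ltr_wpDl// ltW.
Unshelve. all: by end_near. Qed.

Lemma powR_cvg0_comp (R : realType) (T : Type) (F : set_system T) {FF : Filter F}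
    (u : T -> R) (p : R) : 0 < p ->
  (\forall x \near F, 0 < u x) -> u @ F --> 0 -> u x `^ p @[x --> F] --> 0.
Proof.
move=> p0 u0 uF; apply: (@cvg_comp _ _ _ u (@powR R ^~ p) _ 0^'+);
  last exact: powR_cvg0.
move=> A.
rewrite /at_right /= => nA; rewrite /nbhs/=.
have : F [set x | 0 < u x -> A (u x)] by exact: (uF _ nA).
by move: u0; apply: filterS2 => x ux; apply.
Qed.

Lemma powR_continuous (R : realType) (p x : R) :
  0 < x -> {for x, continuous (@powR R ^~ p)}.
Proof.
move=> x0; apply/differentiable_continuous/derivable1_diffP.
by have [] := is_derive1_powR p x0.
Qed.

(** L'Hospital's rule with denominator [x - e]. The value of [H] at [e] does not enter, only its
    limit 0; this suits [F], whose values from [ximax] on are irrelevant. *)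
Lemma slope_cvg_at_left (R : realType) (H dH : R -> R) (e l : R) :
  (\forall x \near e^'-, is_derive (x : R) 1 H (dH x)) ->
  H x @[x --> e^'-] --> 0 -> dH x @[x --> e^'-] --> l ->
  H x / (x - e) @[x --> e^'-] --> l.
Proof.
move=> /near_left_itvP[b be Hd] H0 Hl.
apply: (@lhopital_at_left _ H dH (fun x => x - e) (fun=> 1) b e l) => //.
- move=> x _.
  apply: is_derive_eq (is_deriveB (is_derive_id _ _) (is_derive_cst _ _ _)) _.
  by rewrite subr0.
- rewrite -[X in _ --> X](subrr e); apply: cvgB; last exact: cvg_cst.
  exact: cvg_at_left_filter.
- by under eq_fun do rewrite divr1.
Qed.

(** Both [G + k x] and [k x - G] are nondecreasing; the second bounds the first from above, so the
    first converges by monotonicity. *)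
Lemma is_cvg_at_left_bounded_derive (R : realType) (G dG : R -> R) (e k : R) :
  (\forall x \near e^'-, is_derive (x : R) 1 G (dG x)) ->
  (\forall x \near e^'-, `|dG x| <= k) -> cvg (G x @[x --> e^'-]).
Proof.
move=> nG nk.
have [b be bG] : exists2 b, b < e & forall x, x \in `]b, e[%R ->
    is_derive x 1 G (dG x) /\ `|dG x| <= k.
  by apply/near_left_itvP; near do split.
have lin (c x : R) : is_derive x 1 ( *%R c) c.
  by apply: is_derive_eq (is_deriveZ c (is_derive_id x 1)) _;
    rewrite /GRing.scale/= mulr1.
have up : {in `]b, e[%R &, {homo G + *%R k : x y / x <= y}}.
  apply: (@is_derive_ge0_le _ _ (fun x => dG x + k)) => x /bG[Gx].
    by move=> _; exact: is_deriveD.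
  by rewrite ler_norml; lra.
have down : {in `]b, e[%R &, {homo *%R k - G : x y / x <= y}}.
  apply: (@is_derive_ge0_le _ _ (fun x => k - dG x)) => x /bG[Gx].
    by move=> _; exact: is_deriveB.
  by rewrite ler_norml; lra.
have cvg_up : cvg ((G + *%R k) x @[x --> e^'-]).
  apply: nondecreasing_at_left_is_cvgr.
    near=> c => x y /[!in_itv]/= /andP[cx xe] /andP[cy ye] xy.
    have bc : b < c by near: c; exact: nbhs_left_gt.
    by apply: up; rewrite ?in_itv/= ?xe ?ye ?andbT ?(lt_trans bc).
  near=> c.
  have bc : b < c by near: c; exact: nbhs_left_gt.
  have ce : c < e by near: c; exact: nbhs_left_lt.
  (* From [k c - G c <= k x - G x] follows [G x + k x <= G c - k c + 2 k x], and [x < e]. *)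
  exists (G c - k * c + 2 * (k * e)) => _ /= [x /[!in_itv]/= /andP[cx xe] <-].
  have k0 : 0 <= k.
    by have [|_] := bG c; rewrite ?in_itv/= ?bc//; exact: le_trans (normr_ge0 _).
  have : (( *%R k - G) c <= ( *%R k - G) x).
    by apply: down; rewrite ?in_itv/= ?bc ?ce ?(lt_trans bc cx) ?xe ?(ltW cx).
  have : k * x <= k * e by rewrite ler_wpM2l// ltW.
  by rewrite !fctE; lra.
have -> : G = (G + *%R k) - *%R k by apply/funext => x; rewrite !fctE addrK.
apply: is_cvgB => //; apply/cvg_ex; exists (k * e).
by apply: cvgMl_tmp; exact: cvg_at_left_filter.
Unshelve. all: by end_near. Qed.

Lemma is_derive_within_interior (R : realType) (D : set R) (g : R -> R) (x l : R) :
  nbhs x D -> is_derive_within D g x l -> is_derive x 1 g l.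
Proof.
move=> xD gl; apply/is_derive_slopeP; apply: cvg_trans gl; apply: cvg_app => A DA.
have : x^' D by exact: nbhs_dnbhs.
have : x^' [set y | D y -> A y] by exact: DA.
by apply: filterS2 => y; apply.
Qed.

(** * Behaviour of the flux quotient [W] for the first-order system in [u] and [P] *)

Section flux_quotient.
Variables (R : realType) (m q al be sg n e : R) (u P : R -> R).
Hypotheses (hm : 1 < m) (hq : 0 < q < 1) (hmq : 2 < m + q).
Hypotheses (al0 : 0 <= al) (be0 : 0 < be) (n0 : 0 <= n) (e0 : 0 < e).

(** With [F = u^m], [P = - F'] and [n = N - 1], these are the right-hand sides for [u'] and [P']
    given by the equation. *)
Let du x := - (P x * u x `^ (1 - m) / m).
Let dP x := - (n / x * P x) + al * u x + be * x / m * u x `^ (1 - m) * P x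
  - x `^ sg * u x `^ q.

Hypothesis u_gt0 : \forall x \near e^'-, 0 < u x.
Hypothesis P_gt0 : \forall x \near e^'-, 0 < P x.
Hypothesis u_der : \forall x \near e^'-, is_derive (x : R) 1 u (du x).
Hypothesis P_der : \forall x \near e^'-, is_derive (x : R) 1 P (dP x).
Hypothesis u_cvg0 : u x @[x --> e^'-] --> 0.
Hypothesis P_cvg0 : P x @[x --> e^'-] --> 0.

Let W x := P x * u x `^ (1 - m - q).
Let kappa x := be * x / m - n * u x `^ (m - 1) / x.
(* [E] is u^(m-1) W'. *)
Let E x := kappa x * W x + al * u x `^ (1 - q) - x `^ sg
  + (m + q - 1) / m * W x ^+ 2 * u x `^ (m + q - 2).

(** The exponents met below are integer combinations of 1, [m] and [q]; expressing the powers
    rationally in [x], [x^m] and [x^q] leaves identities for [field]. *)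
Let powE (x : R) : 0 < x ->
  ((x `^ (1 - m) = x / x `^ m) * (x `^ (m - 1) = x `^ m / x) *
   (x `^ (1 - q) = x / x `^ q) *
   (x `^ (1 - m - q) = x / (x `^ m * x `^ q)) *
   (x `^ (1 - m - q - 1) = (x `^ m * x `^ q)^-1) *
   (x `^ (m + q - 2) = x `^ m * x `^ q / x ^+ 2) *
   (x `^ (- (m + q - 2) - 1) = x / (x `^ m * x `^ q)))%type.
Proof.
move=> x0; have xN : x != 0 by rewrite gt_eqF.
have x1 : x `^ 1 = x by rewrite powRr1// ltW.
have pD r s : x `^ (r + s) = x `^ r * x `^ s by rewrite powRD// xN implybT.
rewrite (_ : 1 - m - q - 1 = - (m + q)); last by ring.
rewrite (_ : - (m + q - 2) - 1 = 1 + - (m + q)); last by ring.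
rewrite (_ : m + q - 2 = m + q - 1 - 1); last by ring.
by rewrite !(pD, powRN, x1) expr2 !invfM !mulrA.
Qed.

(** The quadratic term of [E] comes from differentiating the factor [u^(1-m-q)], since [u'] is
    itself proportional to [P]. *)
Let W_der : \forall x \near e^'-, is_derive (x : R) 1 W (u x `^ (1 - m) * E x).
Proof.
near=> x.
have ux : 0 < u x by near: x.
have xx : 0 < x by near: x; exact: nbhs_left_gt.
have [M0 Q0] : 0 < u x `^ m /\ 0 < u x `^ q by rewrite !powR_gt0.
have uX : is_derive x 1 u (du x) by near: x.
have PX : is_derive x 1 P (dP x) by near: x.
have pX := @is_derive1_comp _ (@powR R ^~ (1 - m - q)) u x _ _
  (is_derive1_powR _ ux) uX.
apply: is_derive_eq (is_deriveM PX pX) _.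
rewrite /E /kappa /W /du /dP /= /GRing.scale/= !(powE _ ux).
field.
by rewrite !gt_eqF// (lt_trans ltr01).
Unshelve. all: by end_near. Qed.

(** In this form the bracket [kappa W - x^sg], whose positivity drives [W] upwards, is seen to drive
    [P] upwards too. *)
Let dPE : \forall x \near e^'-,
  dP x = u x `^ q * (kappa x * W x - x `^ sg) + al * u x.
Proof.
near=> x.
have ux : 0 < u x by near: x.
have xx : 0 < x by near: x; exact: nbhs_left_gt.
have [M0 Q0] : 0 < u x `^ m /\ 0 < u x `^ q by rewrite !powR_gt0.
rewrite /dP /kappa /W !(powE _ ux).
field.
by rewrite !gt_eqF// (lt_trans ltr01).
Unshelve. all: by end_near. Qed.

Let id_cvg : x @[x --> e^'-] --> e.
Proof. exact: cvg_at_left_filter. Qed.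

Let powid_cvg : x `^ sg @[x --> e^'-] --> e `^ sg.
Proof. by apply: cvg_at_left_filter; exact: powR_continuous. Qed.

Let kappa_cvg : kappa x @[x --> e^'-] --> be * e / m.
Proof.
rewrite -[be * e / m]subr0; apply: cvgB.
  by apply: cvgMr_tmp; apply: cvgMl_tmp.
rewrite (_ : 0 = n * 0 / e); last by rewrite mulr0 mul0r.
apply: cvgM; last by apply: cvgV => //; rewrite gt_eqF.
by apply: cvgMl_tmp; apply: powR_cvg0_comp => //; rewrite subr_gt0.
Qed.

(** The rest point W*, that is the root of [be * e / m * W = e^sg]. *)
Let Wlim := m * e `^ sg / (be * e).

Let W_gt0 : \forall x \near e^'-, 0 < W x.
Proof.
by near=> x; rewrite mulr_gt0// ?powR_gt0//; near: x.
Unshelve. all: by end_near. Qed.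

(** At level [Wlim + eps] the bracket [kappa W - x^sg] tends to [be * e / m * eps > 0]; the
    remaining terms of [E] and [dP] are nonnegative, so [W] and [P] both increase above that
    level. *)
Let W_lt (eps : R) : 0 < eps -> \forall x \near e^'-, W x < Wlim + eps.
Proof.
move=> eps0.
apply: (@near_lt_of_expelled _ _ _ P dP _ _ W_der) => //.
have k0 : \forall x \near e^'-, 0 < kappa x.
  apply: (cvgr_gt _ kappa_cvg).
  by rewrite divr_gt0 ?mulr_gt0// (lt_trans ltr01).
have k1 : \forall x \near e^'-, 0 < kappa x * (Wlim + eps) - x `^ sg.
  have : kappa x * (Wlim + eps) - x `^ sg @[x --> e^'-] -->
      be * e / m * (Wlim + eps) - e `^ sg by apply: cvgB => //; exact: cvgMr_tmp.
  move=> /cvgr_gt; apply.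
  rewrite (_ : _ - _ = be * e / m * eps).
    by rewrite mulr_gt0// divr_gt0 ?mulr_gt0// (lt_trans ltr01).
  by rewrite /Wlim; field; rewrite !gt_eqF// (lt_trans ltr01).
near=> x => cW.
have ux : 0 < u x by near: x.
have kx : 0 < kappa x by near: x.
have kW : 0 < kappa x * W x - x `^ sg.
  apply: (@lt_le_trans _ _ (kappa x * (Wlim + eps) - x `^ sg)).
    by near: x.
  by rewrite lerD2r ler_pM2l.
split.
  rewrite mulr_gt0 ?powR_gt0//.
  have ? : 0 <= al * u x `^ (1 - q) by rewrite mulr_ge0 ?powR_ge0.
  have ? : 0 <= (m + q - 1) / m * W x ^+ 2 * u x `^ (m + q - 2).
    by rewrite mulr_ge0 ?powR_ge0// mulr_ge0 ?sqr_ge0// divr_ge0//;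
      move: (hm) (hmq); lra.
  by rewrite /E; lra.
rewrite (near dPE x)// ltr_pwDl// ?mulr_gt0 ?powR_gt0//.
by rewrite mulr_ge0// ltW.
Unshelve. all: by end_near. Qed.

(** The upper bound [W_lt] comes first: with [W <= C] the quadratic term of [E] is at most a
    constant times [u^s], and this vanishes as [s > 0]. *)
Let W_gt (eps : R) : 0 < eps -> \forall x \near e^'-, Wlim - eps < W x.
Proof.
move=> eps0.
set s := m + q - 2; set c := Wlim - eps; set C := Wlim + 1.
have s0 : 0 < s by rewrite subr_gt0.
have m0 : 0 < m by exact: lt_trans ltr01 hm.
have C0 : 0 < C.
  by rewrite ltr_pwDr// divr_ge0 ?mulr_ge0 ?powR_ge0 ?(ltW m0) ?(ltW be0) ?(ltW e0).
(* Half the limiting gap: at level [c] the linear part of [E] tends to [- 2 delta]. *)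
set delta := be * e / m * eps / 2.
have delta0 : 0 < delta by rewrite !divr_gt0// !mulr_gt0// invr_gt0.
(* Chosen so that [eta * s / m * C = delta], whence [dZ <= delta u^(1-m)] wherever [W <= C]. *)
pose eta := delta * m / (s * C).
have eta0 : 0 < eta by rewrite divr_gt0 // mulr_gt0.
(* W' <= - delta u^(1-m) while Z' <= delta u^(1-m): u^-s is, up to a bounded
   factor, an antiderivative of u^(1-m). *)
pose Z x := eta * u x `^ (- s).
pose dZ x := eta * s / m * W x * u x `^ (1 - m).
have Z_der : \forall x \near e^'-, is_derive (x : R) 1 Z (dZ x).
  near=> x.
  have ux : 0 < u x by near: x.
  have [M0 Q0] : 0 < u x `^ m /\ 0 < u x `^ q by rewrite !powR_gt0.
  have uX : is_derive x 1 u (du x) by near: x.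
  have pX := @is_derive1_comp _ (@powR R ^~ (- s)) u x _ _
    (is_derive1_powR _ ux) uX.
  apply: is_derive_eq (is_deriveZ _ pX) _.
  rewrite /dZ /du /W /s /= /GRing.scale/= !(powE _ ux).
  by field; rewrite !gt_eqF.
have Z_oo : Z x @[x --> e^'-] --> +oo.
  apply/cvgryPgt => A.
  have /cvgr_lt : u x `^ s @[x --> e^'-] --> 0 by exact: powR_cvg0_comp.
  move=> /(_ (eta / (`|A| + 1))); rewrite divr_gt0// ?ltr_pwDr// => /(_ isT) us.
  near=> x; rewrite (le_lt_trans (ler_norm A))//.
  have ux : 0 < u x by near: x.
  rewrite /Z powRN ltr_pdivlMr ?powR_gt0//.
  apply: (@le_lt_trans _ _ ((`|A| + 1) * u x `^ s)).
    by rewrite ler_wpM2r ?powR_ge0// lerDl.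
  by rewrite mulrC -ltr_pdivlMr ?ltr_pwDr//; near: x.
(* This dominates [E] where [0 < W <= c] and [W <= C]: the nonpositive [n] term of [kappa] is
   dropped, [W] is replaced by [c] in the linear term and by [C] in the quadratic one. *)
have rhs : \forall x \near e^'-,
    be * x / m * c + al * u x `^ (1 - q) - x `^ sg
      + (m + q - 1) / m * C ^+ 2 * u x `^ s < - delta.
  have : be * x / m * c + al * u x `^ (1 - q) - x `^ sg
      + (m + q - 1) / m * C ^+ 2 * u x `^ s @[x --> e^'-] -->
      be * e / m * c + al * 0 - e `^ sg + (m + q - 1) / m * C ^+ 2 * 0.
    apply: cvgD.
      apply: cvgB => //; apply: cvgD.
        by apply: cvgMr_tmp; apply: cvgMr_tmp; apply: cvgMl_tmp.
      by apply: cvgMl_tmp; apply: powR_cvg0_comp => //; move: (hq); lra.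
    by apply: cvgMl_tmp; exact: powR_cvg0_comp.
  move=> /cvgr_lt; apply.
  rewrite (_ : _ + _ = - (delta * 2)); first by rewrite ltrN2 ltr_pMr// ltr1n.
  by rewrite /delta /c /Wlim; field; rewrite !gt_eqF.
apply: (@near_gt_of_absorbed _ _ _ Z dZ _ _ W_der) => //.
near=> x => Wc.
have ux : 0 < u x by near: x.
have xx : 0 < x by near: x; exact: nbhs_left_gt.
have Wx : 0 < W x by near: x.
have WC : W x <= C by apply: ltW; near: x; exact: W_lt.
have pu : 0 < u x `^ (1 - m) by rewrite powR_gt0.
have Edelta : E x <= - delta.
  apply: ltW; apply: le_lt_trans (near rhs x _) => //.
  rewrite /E; apply: lerD; last first.
    rewrite ler_wpM2r ?powR_ge0// ler_wpM2l//; last by rewrite lerXn2r// nnegrE ltW.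
    by rewrite divr_ge0// ?(ltW m0)//; move: (hmq); lra.
  rewrite lerD2r lerD2r.
  apply: (@le_trans _ _ (be * x / m * W x)).
    rewrite ler_wpM2r ?(ltW Wx)// gerBl divr_ge0 ?(ltW xx)// mulr_ge0//.
    exact: powR_ge0.
  by rewrite ler_wpM2l// divr_ge0 ?(ltW m0)// mulr_ge0// ltW.
split.
  by rewrite pmulr_rlt0// (le_lt_trans Edelta)// oppr_lt0.
rewrite /dZ [X in _ + X]mulrC -mulrDr pmulr_rle0//.
have : eta * s / m * W x <= eta * s / m * C.
  by rewrite ler_wpM2l// divr_ge0 ?(ltW m0)// mulr_ge0// ltW.
have -> : eta * s / m * C = delta.
  by rewrite /eta; field; rewrite !gt_eqF.
by move: Edelta; lra.
Unshelve. all: by end_near. Qed.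

Lemma flux_quotient_cvg :
  P x * u x `^ (1 - m - q) @[x --> e^'-] --> m * e `^ sg / (be * e).
Proof.
apply/cvgrPdist_lt => eps eps0; near=> x.
rewrite -[X in `|X - _|]/Wlim -[X in `|_ - X|]/(W x) distrC ltr_distl.
by apply/andP; split; near: x; [exact: W_gt | exact: W_lt].
Unshelve. all: by end_near. Qed.

(** The power [1 - q] is the one for which the derivative of [u^(1-q)] is a constant multiple of
    [W]. *)
Lemma vanishing_profile_cvg :
  u x / (e - x) `^ (1 - q)^-1 @[x --> e^'-] -->
  ((1 - q) * e `^ sg / (be * e)) `^ (1 - q)^-1.
Proof.
have [q0 q1] := andP hq.
have m0 : 0 < m by exact: lt_trans ltr01 hm.
have q1' : 0 < 1 - q by rewrite subr_gt0.
pose dV x := - ((1 - q) / m * W x).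
have V_der : \forall x \near e^'-,
    is_derive (x : R) 1 (fun y => u y `^ (1 - q)) (dV x).
  near=> x.
  have ux : 0 < u x by near: x.
  have [M0 Q0] : 0 < u x `^ m /\ 0 < u x `^ q by rewrite !powR_gt0.
  have uX : is_derive x 1 u (du x) by near: x.
  have pX := @is_derive1_comp _ (@powR R ^~ (1 - q)) u x _ _
    (is_derive1_powR _ ux) uX.
  apply: is_derive_eq pX _.
  rewrite (_ : 1 - q - 1 = - q); last by ring.
  rewrite /dV /du /W powRN !(powE _ ux).
  by field; rewrite !gt_eqF.
have dV_cvg : dV x @[x --> e^'-] --> - ((1 - q) * e `^ sg / (be * e)).
  rewrite (_ : (1 - q) * _ / _ = (1 - q) / m * (m * e `^ sg / (be * e))).
    by apply: cvgN; apply: cvgMl_tmp; exact: flux_quotient_cvg.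
  by field; rewrite !gt_eqF.
have V_cvg0 : u x `^ (1 - q) @[x --> e^'-] --> 0 by exact: powR_cvg0_comp.
have /cvgN := slope_cvg_at_left _ _ _ _ _ V_der V_cvg0 dV_cvg.
rewrite opprK => V_slope.
have lim_gt0 : 0 < (1 - q) * e `^ sg / (be * e).
  by rewrite divr_gt0 ?mulr_gt0 ?powR_gt0.
have := cvg_comp _ _ V_slope (powR_continuous _ (1 - q)^-1 _ lim_gt0).
apply: cvg_trans; apply: near_eq_cvg; near=> x.
have xe : 0 < e - x by rewrite subr_gt0; near: x; exact: nbhs_left_lt.
have ux : 0 < u x by near: x.
rewrite /= !fctE -mulrN -invrN opprB powRM ?powR_ge0 ?invr_ge0 ?(ltW xe)//.
rewrite -powRrM mulfV ?gt_eqF// powRr1 ?(ltW ux)//; congr (_ * _).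
by rewrite -(powR_inv1 (ltW xe)) -powRrM mulN1r powRN.
Unshelve. all: by end_near. Qed.

End flux_quotient.

(** Only the endpoint needs an argument: there the slope of the zero extension is
    [F a y / (y - x0)], so l'Hospital's rule identifies the left derivative with the limit [L] of
    [F']. *)
Lemma setA_of_flux_lt0 (R : realType) (m : R) (F : R -> R -> R)
    (ximax : R -> \bar R) (a x0 L : R) (dF : R -> R) :
  m != 0 -> 0 < a -> xi0 (F a) (ximax a) = x0%:E ->
  (forall x, 0 <= x < x0 -> 0 < F a x) ->
  (forall x, 0 < x < x0 -> is_derive x 1 (F a) (dF x)) ->
  (forall x, 0 < x < x0 -> dF x < 0) ->
  F a y @[y --> x0^'-] --> 0 -> dF y @[y --> x0^'-] --> L -> L < 0 ->
  setA m F ximax a.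
Proof.
move=> m0 a0 hx0 F0 Fd dF0 Flim dFlim L0; split=> //; exists x0 => // x.
move=> /andP[x_gt0].
have extE y : 0 <= y <= x0 ->
    prof m (zero_ext x0 (F a)) y `^ m = if y < x0 then F a y else 0.
  move=> /andP[y0 yx0]; rewrite /prof /zero_ext -powRrM mulVf//.
  by case: ifP => yx; rewrite powRr1// ltW// F0// y0.
rewrite le_eqVlt => /predU1P[xE|xx0].
  have x0_gt0 : 0 < x0 by rewrite -xE.
  rewrite xE; exists L => //.
  have sl : F a y / (y - x0) @[y --> x0^'-] --> L.
    apply: (slope_cvg_at_left _ _ dF) => //.
    apply/near_left_itvP; exists 0 => // y; rewrite in_itv/=; exact: Fd.
  move=> A /sl; rewrite /= /at_left => sA.
  have : \forall y \near x0, y < x0 -> A (F a y / (y - x0)) by exact: sA.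
  apply: filterS => y /= yA yx0 /andP[y0 yx].
  have {}yx : y < x0 by rewrite lt_neqAle yx0.
  by rewrite !extE ?lexx ?y0 ?(ltW yx) ?(ltW x0_gt0)// yx ltxx subr0; exact: yA.
exists (dF x); first by rewrite dF0// x_gt0.
have xI : 0 < x < x0 by rewrite x_gt0.
have : is_derive x 1 (F a) (dF x) by exact: Fd.
move=> /is_derive_slopeP sl A /sl sA.
have xA : x^' [set y | A ((F a y - F a x) / (y - x))] by exact: sA.
have : \forall y \near x^', y < x0 by apply: nbhs_dnbhs; exact: lt_nbhsl.
move: xA; rewrite /within /=; apply: filterS2 => y /= yA yx0 /andP[y0 yx].
by rewrite !extE ?y0 ?yx ?(ltW x_gt0) ?(ltW xx0)// yx0 xx0.
Qed.

(** * From the shooting problem to the first-order system, and the asymptotic expansion *)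

Theorem proposition4p11 (R : realType) (N : nat) (m q sigma : R)
    (hN : (1 <= N)%N) (hm : 1 < m) (hq : 0 < q < 1)
    (hsigma : 2 * (1 - q) / (m - 1) < sigma)
    (F : R -> R -> R) (ximax : R -> \bar R)
    (hF : forall a : R, 0 < a ->
      maximal_solution N m q sigma a (F a) (ximax a))
    (a : R) (ha : setB m F ximax a)
    (x0 : R) (hx0 : xi0 (F a) (ximax a) = x0%:E)
    (hmq : 2 < m + q) :
  prof m (F a) =
    (fun x : R => K3 m q sigma * x0 `^ ((sigma - 1) / (1 - q))
                  * (x0 - x) `^ (1 - q)^-1)
    +o_ (x0^'-) (fun x : R => (x0 - x) `^ (1 - q)^-1).
Proof.
have [q0 q1] := andP hq.
have m0 : 0 < m by exact: lt_trans ltr01 hm.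
have mN0 : m != 0 by rewrite gt_eqF.
have den : 0 < sigma * (m - 1) + 2 * (q - 1).
  by move: hsigma; rewrite ltr_pdivrMr ?subr_gt0//; lra.
have sigma0 : 0 < sigma.
  by rewrite (le_lt_trans _ hsigma)// divr_ge0 ?mulr_ge0//; lra.
have al0 : 0 <= alpha m q sigma by rewrite divr_ge0//; lra.
have be0 : 0 < beta m q sigma by rewrite divr_gt0//; lra.
set al := alpha m q sigma in al0; set be := beta m q sigma in be0.
have [/= a0 /not_orP[notA notC]] := ha.
have [xm0 [[g1 [g2 [Fg1 g1g2 _]] Fpos] ode _ _]] := hF a a0.
(* Finiteness of [xi0] excludes the default value [+oo] in its definition. *)
have [xmE Flim] : ximax a = x0%:E /\ F a x @[x --> x0^'-] --> 0.
  move: (hx0); rewrite /xi0; case: asboolP => [[b bE bF] xE|//].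
  by split=> //; move: bE; rewrite xE => -[->].
rewrite xmE in xm0 Fg1 g1g2 Fpos ode.
have x0_gt0 : 0 < x0 by rewrite -lte_fin.
pose n : R := N%:R - 1.
have n0 : 0 <= n by rewrite subr_ge0 ler1n.
have DE x : 0 < x < x0 -> nbhs x [set x : R | 0 <= x /\ (x%:E < x0%:E)%E].
  move=> /andP[xp xx0]; near=> y; split; first by near: y; exact: lt_le_nbhsr.
  by rewrite lte_fin; near: y; exact: lt_nbhsl.
have Fd x : 0 < x < x0 -> is_derive x 1 (F a) (g1 x).
  move=> xI; apply: is_derive_within_interior (DE x xI) (Fg1 x _).
  by have := nbhs_singleton (DE x xI).
have g1d x : 0 < x < x0 -> is_derive x 1 g1 (g2 x).
  move=> xI; apply: is_derive_within_interior (DE x xI) (g1g2 x _).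
  by have := nbhs_singleton (DE x xI).
have F0 x : 0 <= x < x0 -> 0 < F a x.
  by move=> /andP[xp xx0]; apply: Fpos; split=> //; rewrite lte_fin.
have dFE x : 0 < x < x0 -> derive1 (F a) x = g1 x.
  by move=> /Fd [_ <-]; rewrite derive1E.
have ddFE x : 0 < x < x0 -> derive1 (derive1 (F a)) x = g2 x.
  move=> xI; have [_ <-] := g1d x xI; rewrite derive1E; apply: near_eq_derive.
  have /andP[xp xx0] := xI.
  near=> y; apply: dFE; apply/andP; split; near: y.
    exact: lt_nbhsr.
  exact: lt_nbhsl.
(* As [a] is not in C, [xi1 >= x0], so each [x < x0] lies below some [y] with [F' < 0] on []0,
   y[]. *)
have g1_lt0 x : 0 < x < x0 -> g1 x < 0.
  move=> xI; have /andP[xp xx0] := xI; rewrite -dFE//.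
  have : (x%:E < xi1 (F a) (ximax a))%E.
    rewrite (@lt_le_trans _ _ x0%:E) ?lte_fin// -hx0 leNgt.
    by apply/negP => h; exact: notC.
  move=> /ereal_sup_gt[_ [y [_ _ _ yF] <-]]; rewrite lte_fin => xy.
  by apply: yF; rewrite xp.
pose u := prof m (F a).
have u0 x : 0 < x < x0 -> 0 < u x.
  by move=> /andP[xp xx0]; rewrite powR_gt0// F0// (ltW xp).
have near_in (Q : R -> Prop) :
    (forall x, 0 < x < x0 -> Q x) -> \forall x \near x0^'-, Q x.
  by move=> QI; apply/near_left_itvP; exists 0 => // x; rewrite in_itv; exact: QI.
have ud x : 0 < x < x0 -> is_derive x 1 u (- (- g1 x * u x `^ (1 - m) / m)).
  move=> xI; have /andP[xp xx0] := xI.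
  have FX : 0 < F a x by rewrite F0// (ltW xp).
  apply: is_derive_eq (is_derive1_comp (is_derive1_powR m^-1 FX) (Fd x xI)) _.
  rewrite /u /prof -powRrM (_ : m^-1 * (1 - m) = m^-1 - 1); last by field.
  by field.
have g2E x : 0 < x < x0 -> g2 x = - (n / x * g1 x) - al * u x
    + be * x * - (- g1 x * u x `^ (1 - m) / m) + x `^ sigma * u x `^ q.
  move=> xI; have /andP[xp xx0] := xI.
  have := ode x xp; rewrite lte_fin => /(_ xx0); rewrite /ode_at.
  have -> : derive1 (prof m (F a)) x = - (- g1 x * u x `^ (1 - m) / m).
    by rewrite derive1E; have [_] := ud x xI.
  rewrite ddFE// dFE// (mulrC q) powRrM -/(prof m (F a) x) -/(u x) -/al -/be -/n.
  by lra.
have ulim : u x @[x --> x0^'-] --> 0.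
  apply: powR_cvg0_comp => //; first by rewrite invr_gt0.
  by apply: near_in => x /andP[xp xx0]; rewrite F0// (ltW xp).
have id_cvg : x @[x --> x0^'-] --> x0 by exact: cvg_at_left_filter.
have inv_cvg : x^-1 @[x --> x0^'-] --> x0^-1 by apply: cvgV => //; rewrite gt_eqF.
have pow_cvg p : x `^ p @[x --> x0^'-] --> x0 `^ p.
  by apply: cvg_at_left_filter; exact: powR_continuous.
(* All derivatives of F cancel in G'. *)
pose G x := g1 x + n * F a x / x - be * (x * u x).
pose dG x := - (al + be) * u x + x `^ sigma * u x `^ q - n * F a x / x / x.
have Gd x : 0 < x < x0 -> is_derive x 1 G (dG x).
  move=> xI; have /andP[xp xx0] := xI.
  have xN0 : x != 0 by rewrite gt_eqF.
  have inv_d := is_deriveV xN0 (is_derive_id x (1 : R)).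
  have := is_deriveB (is_deriveD (g1d x xI)
    (is_deriveM (is_deriveZ n (Fd x xI)) inv_d))
    (is_deriveZ be (is_deriveM (is_derive_id x (1 : R)) (ud x xI))).
  move=> h; apply: is_derive_eq h _.
  rewrite /GRing.scale/= /dG g2E//= -[n *: F a x]/(n * F a x).
  by field; rewrite xN0 mN0.
have dGlim : dG x @[x --> x0^'-] --> 0.
  have : dG x @[x --> x0^'-] -->
      - (al + be) * 0 + x0 `^ sigma * 0 - n * 0 / x0 / x0.
    apply: cvgB; last by apply: cvgM => //; apply: cvgM => //; exact: cvgMl_tmp.
    apply: cvgD; first exact: cvgMl_tmp.
    apply: cvgM => //; apply: powR_cvg0_comp => //; exact: near_in.
  by rewrite !mulr0 !mul0r addr0 subr0.
(* Since [dG] tends to 0, it is bounded by 1 near [x0]. *)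
have /cvg_ex[/= L GL] : cvg (G x @[x --> x0^'-]).
  apply: (@is_cvg_at_left_bounded_derive _ _ dG _ 1); first exact: near_in.
  have /cvgrPdist_le/(_ _ ltr01) := dGlim.
  by apply: filterS => x; rewrite sub0r normrN.
(* The terms of [G] other than [F'] vanish at [x0], so [F'] inherits the limit. *)
have g1L : g1 x @[x --> x0^'-] --> L.
  have -> : g1 = fun x => G x - n * F a x / x + be * (x * u x).
    by apply/funext => x; rewrite /G; ring.
  rewrite (_ : L = L - n * 0 / x0 + be * (x0 * 0));
    last by rewrite !(mulr0, mul0r); ring.
  apply: cvgD; last by apply: cvgMl_tmp; exact: cvgM.
  by apply: cvgB => //; apply: cvgM => //; exact: cvgMl_tmp.
(* [L > 0] contradicts [F' < 0], and [L < 0] would put [a] in A. *)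
have L0 : L = 0.
  apply/eqP; rewrite eq_le; apply/andP; split; rewrite leNgt; apply/negP => LN.
    have [x [xp xn]] : exists x, 0 < g1 x /\ g1 x < 0.
      near x0^'- => x; exists x; split; near: x; last exact: near_in.
      exact: cvgr_gt g1L _ LN.
    by move: xp; rewrite ltNge (ltW xn).
  exact/notA/(setA_of_flux_lt0 _ _ _ _ _ _ L g1).
have quot : u x / (x0 - x) `^ (1 - q)^-1 @[x --> x0^'-] -->
    ((1 - q) * x0 `^ sigma / (be * x0)) `^ (1 - q)^-1.
  apply: (@vanishing_profile_cvg _ m q al be sigma n x0 u (fun x => - g1 x)) => //.
  - exact: near_in.
  - by apply: near_in => x /g1_lt0; rewrite oppr_gt0.
  - exact: near_in.
  - apply: near_in => x xI; apply: is_derive_eq (is_deriveN (g1d x xI)) _.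
    by rewrite g2E//=; field; rewrite mN0; have /andP[/gt_eqF-> _] := xI.
  - by rewrite -oppr0 -L0; exact: cvgN.
have KE : ((1 - q) * x0 `^ sigma / (be * x0)) `^ (1 - q)^-1 =
    K3 m q sigma * x0 `^ ((sigma - 1) / (1 - q)).
  rewrite /K3 -/be powRrM -powRM ?powR_ge0 ?divr_ge0 ?(ltW be0) ?subr_ge0 ?(ltW q1)
    ?(ltW (lt_trans q1 hm)) ?(ltW den)//.
  congr (_ `^ _); rewrite powRB ?(gt_eqF x0_gt0) ?implybT// powRr1 ?(ltW x0_gt0)//.
  by field; rewrite !gt_eqF.
(* The little-o bound, divided by the positive [(x0 - x)^(1/(1-q))], is the convergence [quot]. *)
apply/eqaddoP => eps eps0.
move/cvgrPdist_le: quot => /(_ _ eps0) quot; near=> x.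
have xx0 : 0 < x0 - x by rewrite subr_gt0; near: x; exact: nbhs_left_lt.
have t0 : 0 < (x0 - x) `^ (1 - q)^-1 by rewrite powR_gt0.
rewrite (gtr0_norm t0) -KE -ler_pdivrMr// -[X in _ / X](gtr0_norm t0) -normf_div.
rewrite mulrBl mulfK ?gt_eqF// distrC; near: x; exact: quot.
Unshelve. all: by end_near. Qed.
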